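(* Let $\Sigma$ be a compact connected oriented surface and let $\pi,\pi'\in\mathscr G_n(\Sigma)$ be Poisson structures with $Z(\pi)=Z(\pi')=\bigsqcup_{i=1}^n\gamma_i$. If $\pi$ and $\pi'$ are gauge equivalent, then their modular periods are the same around all the zero curves, i.e. $T_{\gamma_i}(\pi)=T_{\gamma_i}(\pi')$ for $i=1,\dots,n$.
   Context: $\mathscr G_n(\Sigma)$ ($n\ge 0$) is the set of Poisson structures $\pi$ on $\Sigma$ whose zero set consists of $n$ smooth disjoint (closed) curves $\gamma_1,\dots,\gamma_n$ and which vanish linearly on each of them (i.e. writing $\pi=f\pi_0$ with $\pi_0$ a nondegenerate Poisson structure on $\Sigma$, $0$ is a regular value of $f\in C^\infty(\Sigma)$). Modular vector field: for a volume form $\nu$ on a Poisson manifold $(M,\pi)$, $X^\nu h=\frac{\mathcal L_{X_h}\nu}{\nu}$ for $h\in C^\infty(M)$, where $X_h$ is the hamiltonian vector field of $h$ ($X_h=\tilde\pi(dh)$ with $\eta(\tilde\pi(\nu))=\pi(\eta,\nu)$). If $\pi$ vanishes on a closed curve $\gamma$ and is nonzero away from $\gamma$ in a neighborhood of $\gamma$, then $X^\nu$ is tangent to $\gamma$ and $X^\nu|_\gamma$ does not depend on $\nu$; the modular period $T_\gamma(\pi)$ is the period of the flow of $X^\nu|_\gamma$ around $\gamma$, and $X^\nu|_\gamma$ induces an orientation of $\gamma$. For $\pi\in\mathscr G_n(\Sigma)$, $Z(\pi)$ denotes the zero set of $\pi$ taken with these induced orientations; $Z(\pi)=Z(\pi')$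 means equality as oriented curves. Gauge equivalence: $\pi$ and $\pi'$ are gauge equivalent if there is a closed $2$-form $B$ on $\Sigma$ with $\pi'=\tau_B(\pi)$, i.e. $\{(\tilde\pi'(\eta),\eta)\}=\{(\tilde\pi(\eta),\eta+B(\tilde\pi(\eta),\cdot))\}$ as subbundles of $T\Sigma\oplus T^*\Sigma$. *)

(* Defs.v *)
From HB Require Import structures.
From mathcomp Require Import all_boot all_order all_algebra.
From mathcomp Require Import all_classical all_reals all_analysis.

Set Implicit Arguments.
Unset Strict Implicit.
Unset Printing Implicit Defensive.

Import Order.TTheory GRing.Theory Num.Theory.
Import numFieldNormedType.Exports.

Local Open Scope classical_set_scope.
Local Open Scope ring_scope.

(* Vectors and covectors of R^2 are rows; with this convention the differential
   of a map at x is v |-> v *m jacobian f x. *)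

(* On an open subset of a finite-dimensional space this is C^oo: every iterated
   directional derivative exists and is differentiable on U. *)
Definition smooth_on (R : realType) (V W : normedModType R)
    (U : set V) (f : V -> W) : Prop :=
  forall (s : seq V) (x : V), U x ->
    differentiable (foldr (fun v g => 'D_v g) f s) x.

Definition partial (R : realType) (a : 'I_2) (f : 'rV[R]_2 -> R)
    (x : 'rV[R]_2) : R :=
  'D_(delta_mx 0 a) f x.

Definition grad (R : realType) (f : 'rV[R]_2 -> R) (x : 'rV[R]_2) : 'rV[R]_2 :=
  \row_a partial a f x.

(* A smooth oriented surface without boundary, given by an oriented atlas. The
   map [chart i] matters only on [dom i], and [ichart i] only on the image
   [chart i @` dom i]; [chart_at] picks a chart around each point. *)
Record oriented_surface (R : realType) := OrientedSurface {
  carrier :> topologicalType;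
  idx : Type;
  dom : idx -> set carrier;
  chart : idx -> carrier -> 'rV[R]_2;
  ichart : idx -> 'rV[R]_2 -> carrier;
  chart_at : carrier -> idx;
  surface_hausdorff : hausdorff_space carrier;
  surface_second_countable : @second_countable carrier;
  dom_open : forall i, open (dom i);
  dom_chart_at : forall p, dom (chart_at p) p;
  image_open : forall i, open (chart i @` dom i);
  chartK : forall i p, dom i p -> ichart i (chart i p) = p;
  chart_continuous : forall i, {within dom i, continuous (chart i)};
  ichart_continuous : forall i,
    {within chart i @` dom i, continuous (ichart i)};
  transition_smooth : forall i j,
    smooth_on (chart i @` (dom i `&` dom j)) (chart j \o ichart i);
  transition_oriented : forall i j x,
    (chart i @` (dom i `&` dom j)) x ->
    0 < \det (jacobian (chart j \o ichart i) x)
}.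

Section Surface.
Variables (R : realType) (S : oriented_surface R).
Implicit Types (i j : idx S) (x : 'rV[R]_2) (p : S).

Definition chart_image i : set 'rV[R]_2 := chart i @` dom i.

Definition overlap i j : set 'rV[R]_2 := chart i @` (dom i `&` dom j).

Definition transition i j : 'rV[R]_2 -> 'rV[R]_2 := chart j \o ichart i.

Definition smooth_fun (h : S -> R) : Prop :=
  forall i, smooth_on (chart_image i) (h \o ichart i).

Definition Csmooth : Type := {h : S -> R | smooth_fun h}.

(* Antisymmetric covariant (resp. contravariant) 2-tensors are families of
   component matrices, one per chart, as functions of the coordinates. With
   u, v tangent rows and eta, nu covector rows,
     B(u, v) = u B v^T   and   pi(eta, nu) = eta pi nu^T. *)
Definition components : Type := idx S -> 'rV[R]_2 -> 'M[R]_2.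

Definition smooth_antisym (w : components) : Prop :=
  forall i, smooth_on (chart_image i) (w i) /\
    forall x, chart_image i x -> (w i x)^T = - w i x.

Definition covariant (w : components) : Prop :=
  forall i j x, overlap i j x ->
    let J := jacobian (transition i j) x in
    w i x = J *m w j (transition i j x) *m J^T.

Definition contravariant (w : components) : Prop :=
  forall i j x, overlap i j x ->
    let J := jacobian (transition i j) x in
    w j (transition i j x) = J^T *m w i x *m J.

Record two_form := TwoForm {
  form_comp :> idx S -> 'rV[R]_2 -> 'M[R]_2;
  form_smooth : smooth_antisym form_comp;
  form_covariant : covariant form_comp
}.

Definition closed_form (B : two_form) : Prop :=
  forall i x, chart_image i x -> forall a b c : 'I_2,
    partial a (fun y => B i y b c) x + partial b (fun y => B i y c a) x
      + partial c (fun y => B i y a b) x = 0.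

Definition volume_form (nu : two_form) : Prop :=
  forall i x, chart_image i x -> nu i x != 0.

(* [poisson_jacobi] is [pi, pi] = 0, i.e. the Jacobi identity of {f, g} =
   pi(df, dg), in coordinates. *)
Record poisson := Poisson {
  poisson_comp :> idx S -> 'rV[R]_2 -> 'M[R]_2;
  poisson_smooth : smooth_antisym poisson_comp;
  poisson_contravariant : contravariant poisson_comp;
  poisson_jacobi : forall i x, chart_image i x -> forall a b c : 'I_2,
    \sum_(l < 2)
      (poisson_comp i x a l * partial l (fun y => poisson_comp i y b c) x
       + poisson_comp i x b l * partial l (fun y => poisson_comp i y c a) x
       + poisson_comp i x c l * partial l (fun y => poisson_comp i y a b) x) = 0
}.

Definition nondegenerate (pi : poisson) : Prop :=
  forall i x, chart_image i x -> pi i x \in unitmx.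

(* pi~ : T^* -> T, determined by eta(pi~(nu)) = pi(eta, nu). *)
Definition sharp (pi : poisson) i x (nu : 'rV[R]_2) : 'rV[R]_2 :=
  nu *m (pi i x)^T.

(* The covector B(u, .). *)
Definition contract (B : two_form) i x (u : 'rV[R]_2) : 'rV[R]_2 :=
  u *m B i x.

Definition gauge_transform (B : two_form) (pi pi' : poisson) : Prop :=
  forall i x, chart_image i x ->
    [set (sharp pi' i x eta, eta) | eta in [set: 'rV[R]_2]] =
    [set (sharp pi i x eta, eta + contract B i x (sharp pi i x eta))
       | eta in [set: 'rV[R]_2]].

Definition gauge_equivalent (pi pi' : poisson) : Prop :=
  exists2 B : two_form, closed_form B & gauge_transform B pi pi'.

Definition zero_set (pi : poisson) : set S :=
  [set p | forall i, dom i p -> pi i (chart i p) = 0].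

Definition closed_curve (gamma : set S) : Prop :=
  exists c : R -> S,
    [/\ continuous c,
        forall i, smooth_on (c @^-1` dom i) (chart i \o c),
        forall i t, dom i (c t) -> 'D_1 (chart i \o c) t != 0,
        forall s t, c s = c t <-> exists k : int, t = s + k%:~R
      & gamma = range c].

Definition zero_curves n (pi : poisson) (gamma : 'I_n -> set S) : Prop :=
  [/\ forall k, closed_curve (gamma k),
      trivIset [set: 'I_n] gamma
    & zero_set pi = \bigcup_k gamma k].

Definition linear_vanishing (pi : poisson) : Prop :=
  exists (pi0 : poisson) (f : S -> R),
    [/\ nondegenerate pi0, smooth_fun f,
        forall i x, chart_image i x -> pi i x = f (ichart i x) *: pi0 i x
      & forall i x, chart_image i x -> f (ichart i x) = 0 ->
          grad (f \o ichart i) x != 0].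

Definition G_ n (pi : poisson) : Prop :=
  (exists gamma : 'I_n -> set S, zero_curves pi gamma) /\ linear_vanishing pi.

(* X_h = pi~(dh). *)
Definition hamiltonian (pi : poisson) (h : Csmooth) i x : 'rV[R]_2 :=
  sharp pi i x (grad (sval h \o ichart i) x).

(* (L_v w)_ab = v^c d_c w_ab + w_cb d_a v^c + w_ac d_b v^c. *)
Definition lie_derivative (v : 'rV[R]_2 -> 'rV[R]_2) (w : 'rV[R]_2 -> 'M[R]_2)
    x : 'M[R]_2 :=
  \matrix_(a, b) \sum_(c < 2)
    (v x 0 c * partial c (fun y => w y a b) x
     + w x c b * partial a (fun y => v y 0 c) x
     + w x a c * partial b (fun y => v y 0 c) x).

(* X^nu as a derivation of smooth functions: the quotient (L_{X_h} nu) / nu of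
   two 2-forms on a surface is the quotient of their dx^0 /\ dx^1 coefficients,
   in any chart. *)
Definition modular_field (pi : poisson) (nu : two_form) (h : Csmooth) : S -> R :=
  fun p =>
    let i := chart_at p in
    let x := chart i p in
    lie_derivative (hamiltonian pi h i) (nu i) x 0 1 / nu i x 0 1.

(* Z(pi) as an oriented curve: the pairs (p, D) where p is a zero of pi and D
   is a tangent vector at p (as a derivation) in the positive direction given
   by the modular vector field. Along the zero set X^nu does not depend on nu,
   so the choice of volume form here and in [modular_period] is immaterial. *)
Definition oriented_zero_set (pi : poisson) : set (S * (Csmooth -> R)) :=
  [set pD | zero_set pi pD.1 /\
    exists (nu : two_form) (c : R), [/\ volume_form nu, 0 < c &
      forall h, pD.2 h = c * modular_field pi nu h pD.1]].

(* [Phi] is the flow on gamma of the vector field X, X a derivation. *)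
Definition flow_on (X : Csmooth -> S -> R) (gamma : set S)
    (Phi : R -> S -> S) : Prop :=
  forall p, gamma p ->
    [/\ Phi 0 p = p,
        forall t, gamma (Phi t p)
      & forall (h : Csmooth) (t : R),
          is_derive t 1 (fun s => sval h (Phi s p)) (X h (Phi t p))].

(* The least T > 0 at which the flow of X^nu on gamma is the identity. *)
Definition modular_period (pi : poisson) (gamma : set S) : R :=
  inf [set T | 0 < T /\
    exists (nu : two_form) (Phi : R -> S -> S),
      [/\ volume_form nu, flow_on (modular_field pi nu) gamma Phi
        & forall p, gamma p -> Phi T p = p]].

End Surface.

(* Main.v *)
Require Import Defs.
From HB Require Import structures.
From mathcomp Require Import all_boot all_order all_algebra.
From mathcomp Require Import all_classical all_reals all_analysis.

Set Implicit Arguments.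
Unset Strict Implicit.
Unset Printing Implicit Defensive.

Import Order.TTheory GRing.Theory Num.Theory.
Import numFieldNormedType.Exports.

Local Open Scope classical_set_scope.
Local Open Scope ring_scope.

(** Gauge equivalence by [B] says, in components, that
      pi = pi' + pi' B^T pi.
    Hence pi' vanishes wherever pi does, and there the correction term, a
    product of two factors that are both zero, vanishes to second order: at the
    zeros of pi the first derivatives of pi and pi' agree
    ([gauge_transform_derive_eq]). The modular vector field of pi, applied to
    [h], depends on pi only through the hamiltonian field of [h] and its first
    derivatives; at a zero of pi the hamiltonian field vanishes, and its
    derivatives depend only on those of pi and on the differential of [h]
    ([is_derive_hamiltonian]).
    So the modular vector fields of pi and pi', for one and the same volume
    form, coincide along the zero set of pi ([modular_field_gauge]). The flows
    that define the modular period live on a curve inside the zero set, so the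
    two periods are infima of the same set of times. *)

Lemma is_derive_mxP (R : realFieldType) (V : normedModType R) (m n : nat)
    (A : V -> 'M[R]_(m, n)) (dA : 'M[R]_(m, n)) (x v : V) :
  is_derive x v A dA <->
  forall i j, is_derive x v (fun y => A y i j) (dA i j).
Proof.
split=> [[Ax <-] i j|Aij].
  apply: DeriveDef; first by move/derivable_mxP: Ax; exact.
  by rewrite derive_mx// mxE.
have Ax : derivable A x v.
  by apply/derivable_mxP => i j; case: (Aij i j).
apply: DeriveDef => //; rewrite derive_mx//; apply/matrixP => i j.
by rewrite mxE; case: (Aij i j).
Qed.

Lemma is_derive_trmx (R : realFieldType) (V : normedModType R) (m n : nat)
    (A : V -> 'M[R]_(m, n)) (dA : 'M[R]_(m, n)) (x v : V) :
  is_derive x v A dA -> is_derive x v (fun y => (A y)^T) dA^T.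
Proof.
move=> /is_derive_mxP Ax; apply/is_derive_mxP => i j.
by under eq_fun do rewrite mxE; rewrite mxE.
Qed.

Lemma is_derive_mulmx (R : realType) (V : normedModType R) (m n p : nat)
    (A : V -> 'M[R]_(m, n)) (B : V -> 'M[R]_(n, p))
    (dA : 'M[R]_(m, n)) (dB : 'M[R]_(n, p)) (x v : V) :
  is_derive x v A dA -> is_derive x v B dB ->
  is_derive x v (fun y => A y *m B y) (dA *m B x + A x *m dB).
Proof.
move=> /is_derive_mxP Ax /is_derive_mxP Bx; apply/is_derive_mxP => i j.
have -> : (fun y => (A y *m B y) i j) =
    \sum_(k < n) ((fun y => A y i k) * (fun y => B y k j)).
  by apply/funext => y; rewrite mxE fct_sumE.
apply: (is_derive_eq (is_derive_sum (fun k => is_deriveM (Ax i k) (Bx k j)))).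
rewrite !mxE -big_split/=; apply: eq_bigr => k _.
by rewrite addrC; congr (_ + _); exact: mulrC.
Qed.

Lemma smooth_on_is_derive (R : realType) (V W : normedModType R) (U : set V)
    (f : V -> W) (x v : V) :
  smooth_on U f -> U x -> is_derive x v f ('D_v f x).
Proof. by move=> fU Ux; exact/derivableP/diff_derivable/(fU [::]). Qed.

Section Gauge.
Variables (R : realType) (S : oriented_surface R) (B : two_form S).
Variables (pi pi' : poisson S).
Hypothesis piB : gauge_transform B pi pi'.

(** With [P], [P'], [b] the components of the two bivectors and of the form,
    [P = P' + P' b^T P]: the point of the graph of pi~ over [eta] moves to the
    point of the graph of pi'~ over [eta + eta P^T b]. *)
Lemma gauge_transform_comp i x : chart_image i x ->
  pi i x = pi' i x + pi' i x *m (B i x)^T *m pi i x.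
Proof.
move=> ix; apply: trmx_inj; apply/row_matrixP => a.
have : [set (sharp pi i x eta, eta + Defs.contract B i x (sharp pi i x eta))
         | eta in [set: 'rV[R]_2]]
    (sharp pi i x (delta_mx 0 a),
     delta_mx 0 a + Defs.contract B i x (sharp pi i x (delta_mx 0 a))).
  by exists (delta_mx 0 a).
rewrite -(piB ix) => -[eta _ [pi'E etaE]].
rewrite !rowE -[LHS]pi'E etaE /sharp /Defs.contract linearD/= !trmx_mul trmxK.
by rewrite mulmxDl mulmxDr !mulmxA.
Qed.

Lemma gauge_transform_eq0 i x : chart_image i x -> pi i x = 0 -> pi' i x = 0.
Proof.
move=> ix pi0; have := gauge_transform_comp ix.
by rewrite pi0 mulmx0 addr0.
Qed.

Lemma gauge_transform_derive_eq i x (v : 'rV[R]_2) : chart_image i x ->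
  pi i x = 0 -> 'D_v (pi i) x = 'D_v (pi' i) x.
Proof.
move=> ix pi0; have pi'0 := gauge_transform_eq0 ix pi0.
have dpi := smooth_on_is_derive v (poisson_smooth pi i).1 ix.
have dpi' := smooth_on_is_derive v (poisson_smooth pi' i).1 ix.
have dB := smooth_on_is_derive v (form_smooth B i).1 ix.
have := is_deriveD dpi'
  (is_derive_mulmx (is_derive_mulmx dpi' (is_derive_trmx dB)) dpi).
rewrite pi0 pi'0 mulmx0 !mul0mx !addr0 => dE; symmetry.
have <- := @derive_val _ _ _ _ _ _ _ dE; apply: near_eq_derive.
near=> y; rewrite /= [RHS]gauge_transform_comp//.
near: y; exact: (open_nbhs_nbhs (conj (@image_open R S i) ix)).
Unshelve. all: by end_near. Qed.

End Gauge.

Section ModularField.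
Variables (R : realType) (S : oriented_surface R).

Lemma chart_in_image (i : idx S) (p : S) : dom i p -> chart_image i (chart i p).
Proof. by exists p. Qed.

(** At a zero of the bivector the second derivatives of [h] drop out of the
    derivative of its hamiltonian field. *)
Lemma is_derive_hamiltonian (pi : poisson S) (h : Csmooth S) i x
    (v : 'rV[R]_2) : chart_image i x -> pi i x = 0 ->
  is_derive x v (hamiltonian pi h i)
    (grad (sval h \o ichart i) x *m ('D_v (pi i) x)^T).
Proof.
move=> ix pi0.
have dpi := smooth_on_is_derive v (poisson_smooth pi i).1 ix.
have dh : derivable (grad (sval h \o ichart i)) x v.
  apply/derivable_mxP => k a; under eq_fun do rewrite mxE.
  exact/diff_derivable/(svalP h i [:: delta_mx 0 a]).
apply: (is_derive_eq (is_derive_mulmx (derivableP dh) (is_derive_trmx dpi))).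
by rewrite pi0 trmx0 mulmx0 add0r.
Qed.

Lemma lie_derivative_eq (u v : 'rV[R]_2 -> 'rV[R]_2)
    (w : 'rV[R]_2 -> 'M[R]_2) x :
  u x = v x ->
  (forall a c, partial a (fun y => u y 0 c) x =
               partial a (fun y => v y 0 c) x) ->
  lie_derivative u w x = lie_derivative v w x.
Proof.
move=> uv duv; apply/matrixP => a b; rewrite !mxE; apply: eq_bigr => c _.
by rewrite uv !duv.
Qed.

Lemma modular_field_gauge (B : two_form S) (pi pi' : poisson S)
    (nu : two_form S) (h : Csmooth S) (p : S) :
  gauge_transform B pi pi' -> zero_set pi p ->
  modular_field pi nu h p = modular_field pi' nu h p.
Proof.
move=> piB /(_ _ (dom_chart_at p)); have ip := chart_in_image (dom_chart_at p).
rewrite /modular_field; set i := chart_at p in ip *; set x := chart i p in ip *.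
move=> pi0.
have pi'0 := gauge_transform_eq0 piB ip pi0.
rewrite (@lie_derivative_eq _ (hamiltonian pi' h i))// => [|a c].
  by rewrite /hamiltonian /sharp pi0 pi'0.
have /is_derive_mxP dX := is_derive_hamiltonian h (delta_mx 0 a) ip pi0.
have /is_derive_mxP dX' := is_derive_hamiltonian h (delta_mx 0 a) ip pi'0.
rewrite /partial (@derive_val _ _ _ _ _ _ _ (dX 0 c)).
by rewrite (@derive_val _ _ _ _ _ _ _ (dX' 0 c)) (gauge_transform_derive_eq piB).
Qed.

End ModularField.

Lemma flow_on_eq (R : realType) (S : oriented_surface R)
    (X Y : Csmooth S -> S -> R) (gamma : set S) (Phi : R -> S -> S) :
  (forall h p, gamma p -> X h p = Y h p) ->
  flow_on X gamma Phi = flow_on Y gamma Phi.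
Proof.
move=> XY; apply/propext; split=> flow p gp; have [? gPhi dPhi] := flow p gp.
  by split=> // h t; rewrite -XY.
by split=> // h t; rewrite XY.
Qed.

Theorem proposition6p1 (R : realType) (S : oriented_surface R)
    (Scompact : compact [set: S]) (Sconnected : connected [set: S])
    (n : nat) (pi pi' : poisson S) (Gpi : G_ n pi) (Gpi' : G_ n pi')
    (gamma : 'I_n -> set S) (Zgamma : zero_curves pi gamma)
    (Zeq : oriented_zero_set pi = oriented_zero_set pi')
    (gauge : gauge_equivalent pi pi') (k : 'I_n) :
  modular_period pi (gamma k) = modular_period pi' (gamma k).
Proof.
have [B _ piB] := gauge; have [_ _ zeroE] := Zgamma.
have flowE nu Phi : flow_on (modular_field pi nu) (gamma k) Phi =
    flow_on (modular_field pi' nu) (gamma k) Phi.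
  apply: flow_on_eq => h p kp; apply: modular_field_gauge piB _.
  by rewrite zeroE; exists k.
rewrite /modular_period; congr inf; apply/seteqP.
split=> T [T0 [nu [Phi [nu0 flow per]]]]; split=> //; exists nu, Phi.
  by split; rewrite -?flowE.
by split; rewrite ?flowE.
Qed.
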